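(* Let $I=(h_1,\ldots,h_m)\subseteq\mathbb{R}[\mathbf{x}]$, $D=\max_j\deg(h_j)$, let $s\ge1$ and $t$ be integers with $D\le s\le\lfloor t/2\rfloor$, let $L^*$ be a generic element of $\mathcal{K}_{t,\succeq}$, and let $\mathcal{G}_t=\mathcal{H}_t\cup\mathcal{W}_t$. Consider the following three statements: (R) $\mathrm{rank}\,M_s(L^* )=\mathrm{rank}\,M_{s-1}(L^* )$; (P2) $\dim\pi_{2s}(\mathcal{G}_t^\perp)=\dim\pi_{s-1}(\mathcal{G}_t^\perp)$ and $\dim\pi_{2s}(\mathcal{G}_t^\perp)=\dim\pi_{2s}((\mathcal{G}_t^+)^\perp)$; (P1) $\dim\pi_s(\mathcal{G}_t^\perp)=\dim\pi_{s-1}(\mathcal{G}_t^\perp)$ and $\dim\pi_s(\mathcal{G}_t^\perp)=\dim\pi_s((\mathcal{G}_t^+)^\perp)$. Then (R) $\Longleftrightarrow$ (P2) $\Longrightarrow$ (P1).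
   Context: $\mathbb{R}[\mathbf{x}]=\mathbb{R}[x_1,\ldots,x_n]$, $\mathbb{R}[\mathbf{x}]_t$ is the subspace of polynomials of degree at most $t$, $\mathbb{N}^n_t=\{\alpha\in\mathbb{N}^n\mid|\alpha|\le t\}$. For $B\subseteq A$, $B^\perp=\{L\in A^*\mid L(b)=0\ \forall b\in B\}$. For $S\subseteq\mathbb{R}[\mathbf{x}]$, $S^+:=S\cup x_1S\cup\cdots\cup x_nS$. $\mathcal{G}_t^\perp$ is taken in $(\mathbb{R}[\mathbf{x}]_t)^*$ and $(\mathcal{G}_t^+)^\perp$ in $(\mathbb{R}[\mathbf{x}]_{t+1})^*$. $\pi_s$ denotes restriction of linear functionals to $\mathbb{R}[\mathbf{x}]_s$. For $L\in(\mathbb{R}[\mathbf{x}]_t)^*$ and $2s\le t$, $M_s(L)$ is the matrix indexed by $\mathbb{N}^n_s$ with $(\alpha,\beta)$-entry $L(\mathbf{x}^{\alpha+\beta})$; $\mathrm{Ker}\,M_s(L)$ is viewed as a subset of $\mathbb{R}[\mathbf{x}]_s$ by identifying a polynomial with its coefficient vector. $\mathcal{H}_t:=\{\mathbf{x}^\alpha h_j\mid|\alpha|+\deg(h_j)\le t,\ j=1,\ldots,m\}$. $\mathcal{K}_{t,\succeq}:=\{L\in\mathcal{H}_t^\perp\mid M_{\lfloor t/2\rfloor}(L)\succeq0\}$, where $\mathcal{H}_t^\perp\subseteq(\mathbb{R}[\mathbf{x}]_t)^*$. $L^*\in\mathcal{K}_{t,\succeq}$ is generic if $\mathrm{rank}\,M_{\lfloor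 t/2\rfloor}(L^* )=\max_{L\in\mathcal{K}_{t,\succeq}}\mathrm{rank}\,M_{\lfloor t/2\rfloor}(L)$. All generic elements have the same kernel $\mathcal{N}_t:=\mathrm{Ker}\,M_{\lfloor t/2\rfloor}(L^* )$, and $\mathcal{W}_t:=\{\mathbf{x}^\alpha g\mid\alpha\in\mathbb{N}^n_{\lfloor t/2\rfloor},\ g\in\mathcal{N}_t\}$. *)

(* Defs.v *)
From HB Require Import structures.
From mathcomp Require Import all_boot all_order all_algebra.
From mathcomp Require Import boolp classical_sets reals.
From mathcomp Require Import mpoly.

Set Implicit Arguments.
Unset Strict Implicit.
Unset Printing Implicit Defensive.

Import Order.TTheory GRing.Theory Num.Theory.
Local Open Scope classical_set_scope.
Local Open Scope ring_scope.

(* N^n_t, and the multi-index in position [i] of its enumeration. *)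
Notation mindex n t := 'X_{1..n < t.+1}.

Definition mindex_val n t (i : 'I_#|{: mindex n t}|) : 'X_{1..n} :=
  bmnm (enum_val i).

(* As [msize p] is the degree of [p] plus one, [polyle F n t] is the space of *)
(* polynomials of degree at most [t] in [n] variables. *)
Section PolyLe.
Context (F : fieldType) (n t : nat).

Definition polyle_pred : {pred {mpoly F[n]}} := [pred p | (msize p <= t.+1)%N].

Lemma polyle_submod_closed : submod_closed polyle_pred.
Proof.
split=> [|c p q]; rewrite !inE ?msize0 // => hp hq.
apply: leq_trans (msizeD_le _ _) _; rewrite geq_max hq andbT.
exact: leq_trans (msizeZ_le _ _) hp.
Qed.

HB.instance Definition _ :=
  GRing.isSubmodClosed.Build F {mpoly F[n]} polyle_pred polyle_submod_closed.

Record polyle :=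
  PolyLe { mpoly_of_polyle :> {mpoly F[n]};
           _ : mpoly_of_polyle \in polyle_pred }.

HB.instance Definition _ := [isSub for @mpoly_of_polyle].
HB.instance Definition _ := [Choice of polyle by <:].
HB.instance Definition _ := [SubChoice_isSubLmodule of polyle by <:].

Lemma msize_polyle (p : polyle) : (msize (val p) <= t.+1)%N.
Proof. exact: (valP p). Qed.

Lemma truncle_subproof (p : {mpoly F[n]}) :
  \sum_(a : mindex n t) p@_a *: 'X_[a] \in polyle_pred.
Proof.
rewrite inE; apply: leq_trans (msize_sum _ _ _) _.
apply/bigmax_leqP_seq => a _ _.
by apply: leq_trans (msizeZ_le _ _) _; rewrite msizeX bmdeg.
Qed.

(* Total version of the coercion of a polynomial of degree at most [t] into *)
(* [polyle F n t]: monomials of degree more than [t] are dropped. *)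
Definition truncle (p : {mpoly F[n]}) : polyle := PolyLe (truncle_subproof p).

Lemma truncleK p : (msize p <= t.+1)%N -> val (truncle p) = p.
Proof. by move=> hp; rewrite {2}(mpolywE hp). Qed.

Lemma valK_truncle (p : polyle) : truncle (val p) = p.
Proof. by apply/val_inj/truncleK/msize_polyle. Qed.

Lemma truncle_is_linear : linear truncle.
Proof.
move=> c p q; apply/val_inj => /=; rewrite scaler_sumr -big_split /=.
by apply: eq_bigr => a _; rewrite mcoeffD mcoeffZ scalerDl scalerA.
Qed.

HB.instance Definition _ :=
  GRing.isLinear.Build F {mpoly F[n]} polyle _ truncle truncle_is_linear.

Lemma polyle_vecaxiom : Vector.axiom #|{: mindex n t}| polyle.
Proof.
exists (fun p : polyle => \row_i (val p)@_(mindex_val i)) => [c p q|].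
  by apply/rowP => i; rewrite !mxE /= mcoeffD mcoeffZ.
exists (fun v : 'rV_#|{: mindex n t}| =>
  truncle (\sum_i v 0 i *: 'X_[mindex_val i])) => [p|v].
  apply/val_inj; rewrite truncleK; last first.
    apply: leq_trans (msize_sum _ _ _) _; apply/bigmax_leqP_seq => i _ _.
    by apply: leq_trans (msizeZ_le _ _) _; rewrite msizeX bmdeg.
  rewrite [RHS](mpolywE (msize_polyle p)) [RHS]big_enum_val /=.
  by apply: eq_bigr => i _; rewrite mxE.
apply/rowP => i; rewrite mxE truncleK; last first.
  apply: leq_trans (msize_sum _ _ _) _; apply/bigmax_leqP_seq => j _ _.
  by apply: leq_trans (msizeZ_le _ _) _; rewrite msizeX bmdeg.
rewrite raddf_sum /= (bigD1 i) //= mcoeffZ mcoeffX eqxx mulr1 big1 ?addr0 //.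
move=> j ji; rewrite mcoeffZ mcoeffX.
by rewrite (inj_eq val_inj) (inj_eq enum_val_inj) (negbTE ji) mulr0.
Qed.

#[hnf] HB.instance Definition _ :=
  Lmodule_hasFinDim.Build F polyle polyle_vecaxiom.

End PolyLe.

Notation dualle F n t := 'Hom(polyle F n t, F^o).

Section Perp.
Context (F : fieldType) (n : nat).

Lemma vspace_of_subproof (V : vectType F) (P : set V) :
    P 0 -> (forall c u v, P u -> P v -> P (c *: u + v)) ->
  exists U : {vspace V}, forall v, v \in U <-> P v.
Proof.
move=> P0 Pl.
pose Q d := `[< exists U : {vspace V}, \dim U = d /\ forall v, v \in U -> P v >].
have exQ : exists d, Q d.
  exists 0%N; apply/asboolP; exists 0%VS; split; first exact: dimv0.
  by move=> v; rewrite memv0 => /eqP ->.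
have ubQ d : Q d -> (d <= \dim (fullv : {vspace V}))%N.
  by move=> /asboolP[U [<- _]]; apply/dimvS/subvf.
case: (ex_maxnP exQ ubQ) => d /asboolP[U [dU PU]] dmax.
exists U => v; split=> [|Pv]; first exact: PU.
have : Q (\dim (<[v]> + U)%VS).
  apply/asboolP; exists (<[v]> + U)%VS; split=> // w.
  by move=> /memv_addP[_ /vlineP[c ->] [u uU ->]]; apply: Pl => //; apply: PU.
move=> /dmax; rewrite -dU => le.
have /eqP -> : U == (<[v]> + U)%VS by rewrite eqEdim addvSr.
by apply: subvP (addvSl _ _) _ (memv_line v).
Qed.

Lemma perp_subproof t (B : set {mpoly F[n]}) :
  exists U : {vspace dualle F n t}, forall L : dualle F n t,
    L \in U <-> (forall p : polyle F n t, B (val p) -> L p = 0).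
Proof.
apply: (@vspace_of_subproof _
  [set L : dualle F n t | forall p : polyle F n t, B (val p) -> L p = 0]) => /=.
  by move=> p _; rewrite zero_lfunE.
by move=> c L1 L2 h1 h2 p Bp; rewrite add_lfunE scale_lfunE h1 ?h2 // scaler0 addr0.
Qed.

(* The annihilator of [B] in the dual of [polyle F n t]; it is the usual one *)
(* when all elements of [B] have degree at most [t]. It is characterized by *)
(* [memv_perp]. *)
Definition perp t (B : set {mpoly F[n]}) : {vspace dualle F n t} :=
  sval (cid (perp_subproof t B)).

Lemma memv_perp t B (L : dualle F n t) :
  L \in perp t B <-> forall p : polyle F n t, B (val p) -> L p = 0.
Proof. exact: (svalP (cid (perp_subproof t B))). Qed.

(* For [s <= t] this is the inclusion of [polyle F n s] in [polyle F n t]. *)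
Definition incle s t : 'Hom(polyle F n s, polyle F n t) :=
  linfun (@truncle F n t \o (val : polyle F n s -> {mpoly F[n]})).

Definition restrict_fun s t (L : dualle F n t) : dualle F n s :=
  (L \o incle s t)%VF.

Lemma restrict_fun_is_linear s t : linear (@restrict_fun s t).
Proof. by move=> c L1 L2; rewrite /restrict_fun comp_lfunDl comp_lfunZl. Qed.

HB.instance Definition _ s t :=
  GRing.isLinear.Build F (dualle F n t) (dualle F n s) _ (@restrict_fun s t)
    (@restrict_fun_is_linear s t).

(* For [s <= t], the restriction map pi_s; see [restrictE]. *)
Definition restrict s t : 'Hom(dualle F n t, dualle F n s) :=
  linfun (@restrict_fun s t).

Lemma restrictE s t (L : dualle F n t) (p : polyle F n s) (q : polyle F n t) :
  val p = val q -> restrict s t L p = L q.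
Proof.
by move=> pq; rewrite lfunE /= comp_lfunE lfunE /= pq valK_truncle.
Qed.

Definition plus_set (S : set {mpoly F[n]}) : set {mpoly F[n]} :=
  S `|` [set p | exists (i : 'I_n), exists2 q, S q & p = 'X_i * q].

End Perp.


Section Moment.
Context (R : realType) (n : nat).

(* The matrix M_s(L), the multi-indices of degree at most [s] being listed in *)
(* the order of their enumeration; it is used for [2 s <= t] only, so that *)
(* [truncle] is the identity on the monomials involved. *)
Definition moment_mx s t (L : dualle R n t) :
    'M[R]_#|{: mindex n s}| :=
  \matrix_(i, j)
    L (truncle t 'X_[(mindex_val i + mindex_val j)%MM]).

Definition coef_vec s (p : {mpoly R[n]}) : 'cV[R]_#|{: mindex n s}| :=
  \col_i p@_(mindex_val i).

Definition ker_moment s t (L : dualle R n t) : set {mpoly R[n]} :=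
  [set p | (msize p <= s.+1)%N /\ moment_mx s L *m coef_vec s p = 0].

Definition psd k (A : 'M[R]_k) : Prop :=
  A^T = A /\ forall v : 'cV[R]_k, 0 <= (v^T *m A *m v) 0 0.

(* The degree, with the convention that the zero polynomial has degree 0. *)
Definition mdegree (p : {mpoly R[n]}) : nat := (msize p).-1.

Context (m : nat) (h : 'I_m -> {mpoly R[n]}).

Definition Hset t : set {mpoly R[n]} :=
  [set p | exists (a : 'X_{1..n}) (j : 'I_m),
     (mdeg a + mdegree (h j) <= t)%N /\ p = 'X_[a] * h j].

Definition Kpsd t : set (dualle R n t) :=
  [set L | L \in perp t (Hset t) /\ psd (moment_mx t./2 L)].

Definition generic t (L : dualle R n t) : Prop :=
  Kpsd L /\ forall L' : dualle R n t, Kpsd L' ->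
    (\rank (moment_mx t./2 L') <= \rank (moment_mx t./2 L))%N.

(* N_t and W_t, computed from a given generic element [L]. *)
Definition Nset t (L : dualle R n t) : set {mpoly R[n]} :=
  ker_moment t./2 L.

Definition Wset t (L : dualle R n t) : set {mpoly R[n]} :=
  [set p | exists (a : 'X_{1..n}) (g : {mpoly R[n]}),
     [/\ (mdeg a <= t./2)%N, Nset L g & p = 'X_[a] * g]].

Definition Gset t (L : dualle R n t) : set {mpoly R[n]} := Hset t `|` Wset L.

End Moment.

(* Main.v *)
(* For [L] in [K_t] with [M_s(L)] and [M_(s-1)(L)] of equal rank, every
   polynomial of degree at most [s] is congruent modulo [Ker M_s(L)] to one of
   degree less than [s]. As [M_(t/2)(L)] is psd, [Ker M_s(L)] lies in [N_t], so
   an element of [G_t^perp] is determined up to degree [2s] by its values in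
   degree less than [s]. Following Curto and Fialkow, the reductions of the
   multiplications by the variables commute, and iterating them gives a normal
   form [phi] whose kernel contains the [h_j] and [N_t]; composing with [phi]
   prolongs any element of [G_t^perp] to [(G_t^+)^perp]. Conversely, (P2) makes
   the annihilator of [G_t^perp] stable under the variables up to degree [2s],
   and by duality it contains [x^a - p] with [deg p < s] for all [|a| <= s];
   applying [L] to the multiples of [x^a - p] shows that it is in [Ker M_s(L)]. *)

Require Import Defs.
From HB Require Import structures.
From mathcomp Require Import all_boot all_order all_algebra.
From mathcomp Require Import boolp classical_sets reals.
From mathcomp Require Import mpoly zify ring.

Set Implicit Arguments.
Unset Strict Implicit.
Unset Printing Implicit Defensive.

Import Order.TTheory GRing.Theory Num.Theory.
Local Open Scope classical_set_scope.
Local Open Scope ring_scope.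

(** * Polynomials and kernels of moment matrices *)

(** Subspaces as predicates: by [lin_closed_mpoly], a property of this kind needs checking on
    monomials only. *)
Definition lin_closed (K : nzRingType) (V : lmodType K) (P : V -> Prop) :=
  P 0 /\ forall c u v, P u -> P v -> P (c *: u + v).

Lemma lin_closed_ker (K : nzRingType) (V : lmodType K) (W : zmodType)
    (s : GRing.Scale.law K W) (f : {linear V -> W | s}) :
  lin_closed (fun u => f u = 0).
Proof.
split=> [|c u v fu fv]; first exact: linear0.
by rewrite linearP fu fv addr0 -{1}(linear0 f) -linearZ_LR scaler0 linear0.
Qed.

Lemma lin_closed_sum (K : nzRingType) (V : lmodType K) (P : V -> Prop)
    (I : Type) (r : seq I) (c : I -> K) (F : I -> V) :
  lin_closed P -> (forall i, P (F i)) -> P (\sum_(i <- r) c i *: F i).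
Proof.
move=> [P0 PD] PF; elim: r => [|i r IHr]; first by rewrite big_nil.
by rewrite big_cons; apply: PD.
Qed.

Section Polynomials.
Context (F : fieldType) (n : nat).
Implicit Types (p q : {mpoly F[n]}) (a b : 'X_{1..n}) (d e : nat).

Lemma lin_closed_mpoly (P : {mpoly F[n]} -> Prop) d p :
    lin_closed P -> (forall a, (mdeg a <= d)%N -> P 'X_[a]) ->
  (msize p <= d.+1)%N -> P p.
Proof.
move=> Pl PX /mpolywE ->; apply: lin_closed_sum => // a.
by apply: PX; rewrite -ltnS bmdeg.
Qed.

Lemma lin_closed_msize d : lin_closed (fun p => (msize p <= d)%N).
Proof.
split=> [|c p q hp hq]; first by rewrite msize0.
apply: leq_trans (msizeD_le _ _) _; rewrite geq_max hq andbT.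
exact: leq_trans (msizeZ_le _ _) hp.
Qed.

Lemma msizeB_leq d p q :
  (msize p <= d)%N -> (msize q <= d)%N -> (msize (p - q) <= d)%N.
Proof.
move=> hp hq; have [_ hD] := lin_closed_msize d.
by rewrite addrC -scaleN1r; apply: hD.
Qed.

Lemma msizeM_leq d e p q :
    (msize p <= d.+1)%N -> (msize q <= e.+1)%N ->
  (msize (p * q) <= (d + e).+1)%N.
Proof.
have [->|p0] := eqVneq p 0; first by rewrite mul0r msize0.
have [->|q0] := eqVneq q 0; first by rewrite mulr0 msize0.
move=> hp hq; have := leq_add hp hq; rewrite addnS addSn msizeM //.
by case: (_ + _)%N.
Qed.

Lemma msizeXM_leq d a p :
  (msize p <= d.+1)%N -> (msize ('X_[a] * p) <= (mdeg a + d).+1)%N.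
Proof. by apply: msizeM_leq; rewrite msizeX. Qed.

Lemma msizeXUM_leq d (i : 'I_n) p :
  (msize p <= d)%N -> (msize ('X_i * p) <= d.+1)%N.
Proof.
case: d => [|d].
  by rewrite leqn0 msize_poly_eq0 => /eqP ->; rewrite mulr0 msize0.
by move/(msizeXM_leq U_(i)); rewrite mdeg1.
Qed.

Lemma mnm_splitU a : (0 < mdeg a)%N -> exists b (i : 'I_n), a = (U_(i) + b)%MM.
Proof.
rewrite lt0n mdeg_eq0 => a0.
have /existsP[i ai] : [exists i, a i != 0%N].
  apply: contraT; rewrite negb_exists => /forallP a0'.
  case/eqP: a0; apply/mnmP => i; rewrite mnm0E; apply/eqP.
  by move: (a0' i); rewrite negbK.
exists (a - U_(i))%MM, i; rewrite addmC submK //; apply/mnm_lepP => j.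
by rewrite mnm1E; case: eqP => // <-; rewrite lt0n.
Qed.

Lemma mnm_split d a :
  (d <= mdeg a)%N -> exists b c, a = (b + c)%MM /\ mdeg c = d.
Proof.
elim: d => [|d IHd] in a *; first by exists a, 0%MM; rewrite addm0 mdeg0.
move=> da; have [|b [i ab]] := @mnm_splitU a; first exact: leq_trans da.
have [|b' [c [bE cd]]] := IHd b.
  by move: da; rewrite ab mdegD mdeg1.
exists b', (U_(i) + c)%MM; rewrite mdegD mdeg1 cd ab bE; split=> //.
by rewrite addmA [(U_(i) + b')%MM]addmC -addmA.
Qed.

Lemma mindex_valK d a :
  (mdeg a <= d)%N -> exists i : 'I_#|{: mindex n d}|, mindex_val i = a.
Proof.
rewrite -ltnS => ad; exists (enum_rank (BMultinom ad)).
by rewrite /mindex_val enum_rankK.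
Qed.

Lemma mdeg_mindex_val d (i : 'I_#|{: mindex n d}|) :
  (mdeg (mindex_val i) <= d)%N.
Proof. by rewrite -ltnS bmdeg. Qed.

Lemma coef_sumE d p : (msize p <= d.+1)%N ->
  p = \sum_(i < #|{: mindex n d}|) p@_(mindex_val i) *: 'X_[mindex_val i].
Proof.
move=> hp; rewrite [LHS](mpolywE hp) /mindex_val.
by rewrite [LHS]big_enum_val /=.
Qed.

End Polynomials.

Section MomentKernel.
Context (F : fieldType) (n : nat) (ell : {scalar {mpoly F[n]}}).
Implicit Types (p q : {mpoly F[n]}) (a b : 'X_{1..n}) (d e k s : nat).

(** The moment matrix of a functional on the whole polynomial ring, so that the algebra is free of
    truncations; [moment_mx s L] is the instance [ell := mev L]. *)
Definition hankel_mx k : 'M[F]_#|{: mindex n k}| :=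
  \matrix_(i, j) ell 'X_[(mindex_val i + mindex_val j)%MM].

(** The kernel of the moment matrix without coordinates; [iskerP] links the two forms. *)
Definition isker k p := (msize p <= k.+1)%N /\
  forall a, (mdeg a <= k)%N -> ell ('X_[a] * p) = 0.

Lemma iskerM k p u :
  isker k p -> (msize u <= k.+1)%N -> ell (u * p) = 0.
Proof.
move=> [_ lp]; apply: (lin_closed_mpoly (P := fun u => ell (u * p) = 0)) => //.
split=> [|c v w lv lw]; first by rewrite mul0r linear0.
by rewrite mulrDl -scalerAl linearP lv lw mulr0 addr0.
Qed.

Lemma hankel_mulE k p i : (msize p <= k.+1)%N ->
  (hankel_mx k *m (\col_j p@_(mindex_val j))) i 0 = ell ('X_[mindex_val i] * p).
Proof.
move=> hp; rewrite mxE [in RHS](coef_sumE hp) mulr_sumr linear_sum.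
by apply: eq_bigr => j _; rewrite !mxE -scalerAr linearZ -mpolyXD mulrC.
Qed.

Lemma iskerP k p :
  isker k p <->
    (msize p <= k.+1)%N /\ hankel_mx k *m (\col_j p@_(mindex_val j)) = 0.
Proof.
split=> -[hp pk]; split=> //.
  apply/colP => i; rewrite hankel_mulE // mxE pk //; exact: mdeg_mindex_val.
move=> a /mindex_valK[i <-]; rewrite -hankel_mulE //.
by rewrite pk mxE.
Qed.

End MomentKernel.

(** * Equality of ranks as reduction to lower degree *)

Section FlatRank.
Context (F : fieldType) (n : nat) (ell : {scalar {mpoly F[n]}}) (k : nat).
Implicit Types (p q : {mpoly F[n]}) (a b : 'X_{1..n}).

Let N := #|{: mindex n k}|.
Let N1 := #|{: mindex n k.+1}|.

Lemma widen_mindex_subproof (i : 'I_N) : (mdeg (mindex_val i) < k.+2)%N.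
Proof. exact/leqW/bmdeg. Qed.

Definition widen_mindex (i : 'I_N) : 'I_N1 :=
  enum_rank (BMultinom (widen_mindex_subproof i)).

Lemma widen_mindexE i : mindex_val (widen_mindex i) = mindex_val i.
Proof. by rewrite [LHS]/mindex_val enum_rankK. Qed.

Let M := hankel_mx ell k.+1.
Let C := colsub widen_mindex M.

Lemma hankel_rowsub : hankel_mx ell k = rowsub widen_mindex C.
Proof. by apply/matrixP => i j; rewrite !mxE !widen_mindexE. Qed.

Lemma mxrank_rowsub_le : (\rank (hankel_mx ell k) <= \rank C)%N.
Proof. by rewrite hankel_rowsub; apply/mxrankS/rowsub_sub. Qed.

Lemma tr_hankel d : (hankel_mx ell d)^T = hankel_mx ell d.
Proof. by apply/matrixP => i j; rewrite !mxE addmC. Qed.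

Lemma mxrank_colsub_le : (\rank C <= \rank M)%N.
Proof.
by rewrite -mxrank_tr -(mxrank_tr M) trmx_mxsub; apply/mxrankS/rowsub_sub.
Qed.

Lemma flat_projection : \rank M = \rank (hankel_mx ell k) ->
  exists rho : {linear {mpoly F[n]} -> {mpoly F[n]}},
    [/\ forall p, (msize (rho p) <= k.+1)%N,
        forall p, (msize p <= k.+2)%N -> isker ell k.+1 (p - rho p) &
        forall p, isker ell k.+1 p -> rho p = 0].
Proof.
move=> rkM.
have MC : (M^T <= C^T)%MS.
  rewrite trmx_mxsub -(mxrank_leqif_sup (rowsub_sub _ _)) -trmx_mxsub.
  by rewrite !mxrank_tr eqn_leq mxrank_colsub_le rkM mxrank_rowsub_le.
pose G := (pinvmx C^T)^T.
have CGM : C *m (G *m M) = M.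
  by apply: trmx_inj; rewrite !trmx_mul trmxK -[RHS](mulmxKpV MC).
(* For [p] of degree at most [k.+1] this is entry [j] of [G (M p)]; writing it with [ell] makes it
   linear in all [p]. *)
pose c p j := \sum_i G j i * ell ('X_[mindex_val i] * p).
pose rho p : {mpoly F[n]} := \sum_j c p j *: 'X_[mindex_val j].
have rho_lin : linear rho.
  move=> x p q; rewrite scaler_sumr -big_split; apply: eq_bigr => j _ /=.
  rewrite scalerA -scalerDl; congr (_ *: _).
  rewrite mulr_sumr -big_split; apply: eq_bigr => i _ /=.
  by rewrite mulrDr -scalerAr linearP /= mulrDr mulrCA.
pose rhoL : {linear {mpoly F[n]} -> {mpoly F[n]}} :=
  HB.pack rho (GRing.isLinear.Build _ _ _ _ rho rho_lin).
have rho_size p : (msize (rho p) <= k.+1)%N.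
  apply: (lin_closed_sum (P := fun q => (msize q <= k.+1)%N)).
    exact: lin_closed_msize.
  by move=> j; rewrite msizeX bmdeg.
exists rhoL; split=> //= p.
  move=> hp; split; first by apply: msizeB_leq hp _; apply: leqW.
  move=> a /mindex_valK[i <-]; rewrite mulrBr linearB /= -hankel_mulE //.
  pose v : 'cV_N1 := \col_j p@_(mindex_val j).
  apply/eqP; rewrite subr_eq0; apply/eqP.
  have -> : M *m v = C *m (G *m (M *m v)).
    by rewrite !mulmxA; congr (_ *m _); rewrite -mulmxA.
  rewrite mxE mulr_sumr linear_sum.
  apply: eq_bigr => j _; rewrite -scalerAr linearZ -mpolyXD mulrC /=.
  have -> : (G *m (M *m v)) j 0 = c p j.
    by rewrite mxE; apply: eq_bigr => i' _; rewrite hankel_mulE.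
  by rewrite !mxE widen_mindexE mulrC.
move=> [hp pk]; rewrite /rho big1 // => j _.
by rewrite /c big1 ?scale0r // => i _; rewrite pk ?mulr0 // mdeg_mindex_val.
Qed.

(** With [E] the coefficients of the reductions, [M = C E], and restricting rows gives
    [C^T = hankel_mx ell k * E] by symmetry. Hence rank [M] is at most rank [C], which is at most
    the rank of [hankel_mx ell k]. *)
Lemma flat_mxrank :
    (forall a, (mdeg a <= k.+1)%N ->
       exists2 p, (msize p <= k.+1)%N & isker ell k.+1 ('X_[a] - p)) ->
  \rank M = \rank (hankel_mx ell k).
Proof.
move=> H.
have /choice[r rP] (i : 'I_N1) : exists p, (msize p <= k.+1)%N /\
    isker ell k.+1 ('X_[mindex_val i] - p).
  by have [p] := H _ (mdeg_mindex_val i); exists p.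
pose E : 'M_(N, N1) := \matrix_(j, i) (r i)@_(mindex_val j).
have ME : M = C *m E.
  apply/matrixP => i j; rewrite mxE mpolyXD; have [rs [_ rk]] := rP j.
  have := rk (mindex_val i) (mdeg_mindex_val i).
  rewrite mulrBr linearB /= => /eqP; rewrite subr_eq0 => /eqP ->.
  rewrite [in LHS](coef_sumE rs) mulr_sumr linear_sum mxE.
  apply: eq_bigr => l _; rewrite -scalerAr linearZ -mpolyXD mulrC /=.
  by rewrite !mxE widen_mindexE.
have CE : C^T = hankel_mx ell k *m E.
  by rewrite trmx_mxsub tr_hankel -/M {1}ME -mul_rowsub_mx hankel_rowsub.
apply/eqP; rewrite eqn_leq (leq_trans mxrank_rowsub_le mxrank_colsub_le) andbT.
rewrite ME; apply: leq_trans (mxrankM_maxl _ _) _.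
by rewrite -mxrank_tr CE mxrankM_maxl.
Qed.

End FlatRank.

(** * Normal forms modulo the kernel of a flat moment matrix *)

Section FlatExtension.
Context (F : fieldType) (n : nat) (ell : {scalar {mpoly F[n]}}) (k : nat).
Context (rho : {linear {mpoly F[n]} -> {mpoly F[n]}}).
Context (rho_size : forall p, (msize (rho p) <= k.+1)%N).
Context (rho_res :
  forall p, (msize p <= k.+2)%N -> isker ell k.+1 (p - rho p)).
Context (rho_ker : forall p, isker ell k.+1 p -> rho p = 0).
Implicit Types (p q u : {mpoly F[n]}) (a b : 'X_{1..n}) (i j : 'I_n).

(** A test monomial of degree [k.+1] differs from its reduction, of degree at most [k], by a kernel
    element, and [ell] vanishes on the product of that element with [u]. *)
Lemma flat_isker u : (msize u <= k.+2)%N ->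
  (forall a, (mdeg a <= k)%N -> ell ('X_[a] * u) = 0) -> isker ell k.+1 u.
Proof.
move=> su uk; split=> // a ak.
rewrite -[X in X * u](subrK (rho 'X_[a])) mulrDl linearD /= mulrC.
rewrite (iskerM (rho_res _) su) ?msizeX // add0r.
apply: (lin_closed_mpoly (P := fun v => ell (v * u) = 0) _ uk) => //.
split=> [|c v w lv lw]; first by rewrite mul0r linear0.
by rewrite mulrDl -scalerAl linearP lv lw mulr0 addr0.
Qed.

Lemma iskerXU i q : isker ell k.+1 q -> (msize q <= k.+1)%N ->
  isker ell k.+1 ('X_i * q).
Proof.
move=> [_ qk] sq; apply: flat_isker; first exact: msizeXUM_leq.
by move=> a ak; rewrite mulrA -mpolyXD qk // mdegD mdeg1 addn1.
Qed.

Lemma rho_comm i j p : (msize p <= k.+1)%N ->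
  rho ('X_i * rho ('X_j * p)) = rho ('X_j * rho ('X_i * p)).
Proof.
move=> sp; apply/eqP; rewrite -subr_eq0 -linearB; apply/eqP/rho_ker.
apply: flat_isker; first by apply: msizeB_leq; apply: msizeXUM_leq.
move=> a ak.
pose q l := 'X_l * p - rho ('X_l * p).
have lq l l' : ell ('X_[a + U_(l')] * q l) = 0.
  have [_ -> //] := rho_res (msizeXUM_leq l sp).
  by rewrite mdegD mdeg1 addn1.
(* The terms in [x_i x_j p] cancel, leaving only residuals of [rho], which are in the kernel. *)
have -> : 'X_[a] * ('X_i * rho ('X_j * p) - 'X_j * rho ('X_i * p)) =
    'X_[a + U_(j)] * q i - 'X_[a + U_(i)] * q j.
  by rewrite !mpolyXD /q; ring.
by rewrite linearB /= !lq subr0.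
Qed.

(** Replacing a factor of degree exactly [k.+1] by its image under [rho] lowers the degree. That
    [p - b] lies in the span of the products [x^a q] is expressed by membership in every subspace
    [P] containing them, ready for [P] the kernel of various linear maps. *)
Lemma flat_reduction d p : (msize p <= d.+1)%N ->
  exists2 b, (msize b <= k.+1)%N &
    forall P : {mpoly F[n]} -> Prop, lin_closed P ->
      (forall a q, (mdeg a + k.+1 <= d)%N -> isker ell k.+1 q ->
         P ('X_[a] * q)) ->
      P (p - b).
Proof.
elim: d p => [|d IHd] p sp.
  by exists p => [|P [P0 _] _]; [apply: leq_trans sp _ | rewrite subrr].
pose Q p := exists2 b, (msize b <= k.+1)%N &
  forall P : {mpoly F[n]} -> Prop, lin_closed P ->
    (forall a q, (mdeg a + k.+1 <= d.+1)%N -> isker ell k.+1 q ->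
       P ('X_[a] * q)) ->
    P (p - b).
apply: (lin_closed_mpoly (P := Q) _ _ sp) => {p sp} [|a ad].
  split=> [|c u v [bu su Pu] [bv sv Pv]].
    by exists 0 => [|P [P0 _] _]; rewrite ?msize0 // subrr.
  have [_ sD] := lin_closed_msize F n k.+1.
  exists (c *: bu + bv); first exact: sD.
  move=> P Pl Pq; rewrite opprD addrACA -scalerBr.
  by apply: Pl.2; [apply: Pu | apply: Pv].
have [ak|ka] := leqP (mdeg a) k.
  by exists 'X_[a] => [|P [P0 _] _]; rewrite ?msizeX // subrr.
have [e [c [aE ck]]] := mnm_split ka; rewrite {}aE mdegD ck in ad *.
have [|b sb Pb] := IHd ('X_[e] * rho 'X_[c]).
  apply: leq_trans (msizeXM_leq _ (rho_size _)) _.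
  by rewrite ltnS -ltnS -addnS.
exists b => // P Pl Pq.
have -> : 'X_[e + c] - b = 1 *: ('X_[e] * ('X_[c] - rho 'X_[c]))
    + ('X_[e] * rho 'X_[c] - b).
  by rewrite scale1r mulrBr addrA subrK mpolyXD.
apply: Pl.2; first by apply: Pq => //; apply: rho_res; rewrite msizeX ck.
by apply: Pb => // a' q a'd; apply: Pq; apply: leqW.
Qed.

Definition nf_step i p := rho ('X_i * p).

(** Normal form of the monomial [x^a]: starting from [rho 1], multiply by one variable at a time and
    reduce after each step. *)
Definition nf_seq (r : seq 'I_n) a :=
  foldr (fun i v => iter (a i) (nf_step i) v) (rho 1) r.

Lemma nf_iter_size i m v :
  (msize v <= k.+1)%N -> (msize (iter m (nf_step i) v) <= k.+1)%N.
Proof. by case: m => //= m _; apply: rho_size. Qed.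

Lemma nf_iter_comm i j m v : (msize v <= k.+1)%N ->
  iter m (nf_step i) (nf_step j v) = nf_step j (iter m (nf_step i) v).
Proof.
move=> sv; elim: m => //= m ->.
by rewrite [LHS]rho_comm //; apply: nf_iter_size.
Qed.

Lemma nf_seq_size r a : (msize (nf_seq r a) <= k.+1)%N.
Proof.
by elim: r => [|i r IHr] /=; [apply: rho_size | apply: nf_iter_size].
Qed.

(** By [rho_comm] the new factor [x_j] passes through the iterations for the other variables. *)
Lemma nf_seqU r j a : uniq r ->
  nf_seq r (U_(j) + a)%MM =
    if j \in r then nf_step j (nf_seq r a) else nf_seq r a.
Proof.
elim: r => //= i r IHr /andP[ir /IHr ->].
rewrite inE mnmDE mnm1E; have [->|ji] /= := eqVneq j i; last first.
  by rewrite add0n; case: ifP => // _; rewrite nf_iter_comm ?nf_seq_size.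
by rewrite (negbTE ir).
Qed.

Definition nf_mon := nf_seq (enum 'I_n).

Lemma nf_mon0 : nf_mon 0%MM = rho 1.
Proof. by rewrite /nf_mon; elim: (enum _) => //= i r ->; rewrite mnm0E. Qed.

Lemma nf_monU j a : nf_mon (U_(j) + a)%MM = rho ('X_j * nf_mon a).
Proof. by rewrite /nf_mon nf_seqU ?enum_uniq // mem_enum. Qed.

(** [phi] extends [nf_mon] linearly and drops monomials of degree above [d], hence the bound deg [p]
    < [d] in the second property. The third follows by induction on the degree, since
    [x_i (x^b - rho x^b)] is in the kernel by [iskerXU]. *)
Lemma flat_extension d : (k < d)%N ->
  exists phi : {linear {mpoly F[n]} -> {mpoly F[n]}},
    [/\ forall p, (msize (phi p) <= k.+1)%N,
        forall i p, (msize p <= d)%N ->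
          phi ('X_i * p) = rho ('X_i * phi p) &
        forall p, (msize p <= k.+2)%N -> phi p = rho p].
Proof.
move=> kd.
pose phi p : {mpoly F[n]} := \sum_(a : mindex n d) p@_a *: nf_mon a.
have phi_lin : linear phi.
  move=> x p q; rewrite scaler_sumr -big_split; apply: eq_bigr => a _ /=.
  by rewrite scalerA -scalerDl mcoeffD mcoeffZ.
pose phiL : {linear {mpoly F[n]} -> {mpoly F[n]}} :=
  HB.pack phi (GRing.isLinear.Build _ _ _ _ phi phi_lin).
have phiX a : (mdeg a <= d)%N -> phiL 'X_[a] = nf_mon a.
  rewrite -ltnS => ad; rewrite /= /phi (bigD1 (BMultinom ad)) //= big1.
    by rewrite mcoeffX eqxx scale1r addr0.
  move=> b ba; rewrite mcoeffX; case: eqP => [ab|_]; last by rewrite scale0r.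
  by case/eqP: ba; apply: val_inj.
have phiXU i p : (msize p <= d)%N -> phiL ('X_i * p) = rho ('X_i * phiL p).
  case: d => [|d] in kd phi phi_lin phiL phiX * => // sp.
  apply: (lin_closed_mpoly
    (P := fun p => phiL ('X_i * p) = rho ('X_i * phiL p))) sp.
    split=> [|c u v Hu Hv]; first by rewrite !(mulr0, linear0).
    by rewrite mulrDr -scalerAr !linearP Hu Hv mulrDr -scalerAr linearP.
  move=> a ad; rewrite -mpolyXD !phiX ?nf_monU ?mdegD ?mdeg1 //.
  exact: leqW.
exists phiL; split=> // p.
  apply: (lin_closed_sum (P := fun q => (msize q <= k.+1)%N)).
    exact: lin_closed_msize.
  by move=> a; apply: nf_seq_size.
move=> sp; apply: (lin_closed_mpoly (P := fun p => phiL p = rho p)) sp => {p}.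
  split=> [|c u v Hu Hv]; first by rewrite !linear0.
  by rewrite !linearP Hu Hv.
move=> a; move: {2}(mdeg a) (erefl (mdeg a)) => m am.
elim: m => [|m IHm] in a am *.
  move/eqP: am; rewrite mdeg_eq0 => /eqP -> _.
  by rewrite phiX ?mdeg0 // nf_mon0 mpolyX0.
have [|b [i aE]] := @mnm_splitU n a; first by rewrite am.
rewrite aE mdegD mdeg1 ltnS in am * => bk; case: am => bm.
rewrite mpolyXD phiXU ?msizeX; last exact: leq_ltn_trans bk kd.
rewrite IHm //; last exact: leqW.
apply/esym/eqP; rewrite -subr_eq0 -linearB -mulrBr; apply/eqP/rho_ker.
apply: iskerXU; first by apply: rho_res; rewrite msizeX ltnS; apply: leqW.
by apply: msizeB_leq; rewrite ?msizeX.
Qed.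

End FlatExtension.

(** * Duality *)

Section LinearAlgebra.
Context (K : fieldType) (V : vectType K).

Lemma dual_span (U : {vspace V}) N (e : 'I_N -> {scalar V}) (f : {scalar V}) :
    (forall u, u \in U -> (forall i, e i u = 0) -> f u = 0) ->
  exists c : 'I_N -> K, forall u, u \in U -> f u = \sum_i c i * e i u.
Proof.
move=> Uf; pose b := vbasis U.
pose A : 'M_(\dim U, N) := \matrix_(l, i) e i b`_l.
pose g : 'rV_(\dim U) := \row_l f b`_l.
have : (g <= A^T)%MS.
  (* A column of [Z] holds the coordinates of a vector of [U] killed by every [e i], hence by
     [f]. *)
  pose Z := cokermx A^T; suff gZ : g *m Z = 0 by rewrite submxE gZ.
  apply/rowP => j; rewrite mxE [RHS]mxE.
  pose u := \sum_l Z l j *: b`_l.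
  have fu (l : {scalar V}) : l u = \sum_i Z i j * l b`_i.
    by rewrite linear_sum; apply: eq_bigr => i _; rewrite linearZ.
  transitivity (f u).
    by rewrite fu; apply: eq_bigr => l _; rewrite mxE mulrC.
  apply: Uf => [|i].
    apply: memv_suml => l _; apply/memvZ/vbasis_mem/mem_nth.
    by rewrite size_tuple.
  have /matrixP/(_ i j) : A^T *m Z = 0 by apply: mulmx_coker.
  rewrite mxE [RHS]mxE => AZ; rewrite fu -[RHS]AZ; apply: eq_bigr => l _.
  by rewrite !mxE mulrC.
move=> /submxP[D gD]; exists (D 0) => u /coord_vbasis ->.
rewrite linear_sum; under [RHS]eq_bigr do rewrite linear_sum mulr_sumr.
rewrite exchange_big; apply: eq_bigr => l _; rewrite linearZ /=.
have /rowP/(_ l) := gD; rewrite !mxE => ->; rewrite mulr_sumr.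
by apply: eq_bigr => i _; rewrite linearZ /= !mxE mulrCA.
Qed.

Context (W W' : vectType K) (f : 'Hom(V, W)) (g : 'Hom(V, W')).
Context (U : {vspace V}) (fg : forall u, u \in U -> f u = 0 -> g u = 0).

Let ker_sub : (U :&: lker f <= U :&: lker g)%VS.
Proof.
apply/subvP => u; rewrite !memv_cap => /andP[uU]; rewrite uU !memv_ker /=.
by move=> /eqP /fg -> //.
Qed.

Lemma limg_dim_le : (\dim (g @: U) <= \dim (f @: U))%N.
Proof.
have := dimvS ker_sub; have := limg_ker_dim f U; have := limg_ker_dim g U.
lia.
Qed.

Lemma limg_dim_eq_ker : \dim (g @: U) = \dim (f @: U) ->
  forall u, u \in U -> g u = 0 -> f u = 0.
Proof.
move=> dfg u uU gu; apply/eqP; rewrite -memv_ker.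
have /eqP kE : (U :&: lker f == U :&: lker g)%VS.
  rewrite eqEdim ker_sub /=.
  have := limg_ker_dim f U; have := limg_ker_dim g U; lia.
have : u \in (U :&: lker g)%VS by rewrite memv_cap uU memv_ker gu /=.
by rewrite -kE memv_cap => /andP[].
Qed.

End LinearAlgebra.

(** * Functionals of bounded degree and dimensions of their restrictions *)

Section DualFunctionals.
Context (F : fieldType) (n : nat).
Implicit Types (p q : {mpoly F[n]}) (B : set {mpoly F[n]}).

(* [mev Lam] is [Lam] extended by zero to the monomials of degree above [t]. *)
Definition mev t (Lam : dualle F n t) p : F := Lam (truncle t p).

Lemma mev_is_scalar t (Lam : dualle F n t) : scalar (mev Lam).
Proof. by move=> c p q; rewrite /mev !linearP. Qed.

HB.instance Definition _ t (Lam : dualle F n t) :=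
  GRing.isLinear.Build F {mpoly F[n]} F *%R (mev Lam) (mev_is_scalar Lam).

(** Evaluation at [p] as a linear form on the dual, the shape that [dual_span] takes. *)
Definition mev_at t p (Lam : dualle F n t) : F := mev Lam p.

Lemma mev_at_is_scalar t p : scalar (@mev_at t p).
Proof. by move=> c L1 L2; rewrite /mev_at /mev add_lfunE scale_lfunE. Qed.

HB.instance Definition _ t p :=
  GRing.isLinear.Build F (dualle F n t) F *%R (@mev_at t p)
    (@mev_at_is_scalar t p).

Lemma mev_val t (Lam : dualle F n t) (p : polyle F n t) :
  mev Lam (val p) = Lam p.
Proof. by rewrite /mev valK_truncle. Qed.

Lemma mev_restrict s t (Lam : dualle F n t) p : (s <= t)%N ->
  (msize p <= s.+1)%N -> mev (restrict F n s t Lam) p = mev Lam p.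
Proof.
move=> st sp; apply: restrictE; rewrite !truncleK //.
exact: leq_trans sp _.
Qed.

Lemma eq_restrict s t t' (Lam : dualle F n t) (Lam' : dualle F n t') :
  (s <= t)%N -> (s <= t')%N ->
  (restrict F n s t Lam = restrict F n s t' Lam' <->
   forall p, (msize p <= s.+1)%N -> mev Lam p = mev Lam' p).
Proof.
move=> st st'; split=> [rE p sp|LE].
  by rewrite -(mev_restrict _ st) // rE mev_restrict.
apply/lfunP => p; rewrite -2!mev_val !mev_restrict ?LE //; exact: msize_polyle.
Qed.

Lemma restrict_eq0 s t (Lam : dualle F n t) : (s <= t)%N ->
  (restrict F n s t Lam = 0 <->
   forall p, (msize p <= s.+1)%N -> mev Lam p = 0).
Proof.
move=> st; rewrite -[0](linear0 (restrict F n s t)) (eq_restrict _ _ st st).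
by split=> H p sp; rewrite H // /mev zero_lfunE.
Qed.

Lemma mem_perp t B (Lam : dualle F n t) : Lam \in perp t B <->
  forall p, (msize p <= t.+1)%N -> B p -> mev Lam p = 0.
Proof.
rewrite memv_perp; split=> [LB p sp Bp|LB p Bp].
  by apply: LB; rewrite truncleK.
by rewrite -mev_val; apply: LB => //; apply: msize_polyle.
Qed.

Lemma scalar_dualle t (l : {scalar {mpoly F[n]}}) :
  exists Lam : dualle F n t,
    forall p, (msize p <= t.+1)%N -> mev Lam p = l p.
Proof.
pose f (p : polyle F n t) : F^o := l (val p).
have f_lin : linear f by move=> c p q; rewrite /f !linearP.
pose fL : {linear polyle F n t -> F^o} :=
  HB.pack f (GRing.isLinear.Build _ _ _ _ f f_lin).
by exists (linfun fL) => p sp; rewrite /mev lfunE /= /f truncleK.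
Qed.

Lemma perp_plus_restrict t B (Lam : dualle F n t.+1) :
  Lam \in perp t.+1 (plus_set B) -> restrict F n t t.+1 Lam \in perp t B.
Proof.
move=> /mem_perp LB; apply/mem_perp => p sp Bp.
by rewrite mev_restrict //; apply: LB; [apply: leqW | left].
Qed.

(** Since [plus_set B] contains [x_i B], the shifted functional annihilates [B]. *)
Lemma perp_plus_shift t B (Lam : dualle F n t.+1) (i : 'I_n) :
  Lam \in perp t.+1 (plus_set B) ->
  exists2 Lam' : dualle F n t, Lam' \in perp t B &
    forall p, (msize p <= t.+1)%N -> mev Lam' p = mev Lam ('X_i * p).
Proof.
move=> /mem_perp LB; pose f p := mev Lam ('X_i * p).
have f_lin : scalar f by move=> c p q; rewrite /f mulrDr -scalerAr linearP.
pose fL : {scalar {mpoly F[n]}} :=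
  HB.pack f (GRing.isLinear.Build _ _ _ _ f f_lin).
have [Lam' L'E] := scalar_dualle t fL; exists Lam' => //.
apply/mem_perp => p sp Bp; rewrite L'E //; apply: LB.
  exact: msizeXUM_leq.
by right; exists i; exists p.
Qed.

(** Restriction to degree [s'] factors through degree [s], so equal dimensions mean that nothing
    more is lost in between. *)
Lemma dim_restrictE s s' t (U : {vspace dualle F n t}) :
    (s' <= s)%N -> (s <= t)%N ->
  \dim (restrict F n s t @: U) = \dim (restrict F n s' t @: U) <->
  (forall Lam, Lam \in U ->
     (forall p, (msize p <= s'.+1)%N -> mev Lam p = 0) ->
     forall p, (msize p <= s.+1)%N -> mev Lam p = 0).
Proof.
move=> ss st; have st' := leq_trans ss st.
have ker_sub Lam : Lam \in U ->
    restrict F n s t Lam = 0 -> restrict F n s' t Lam = 0.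
  move=> _ /(restrict_eq0 _ st) L0; apply/(restrict_eq0 _ st') => p sp.
  by apply: L0; apply: leq_trans sp _.
split=> [dE Lam LU /(restrict_eq0 _ st') L0|H].
  by apply/(restrict_eq0 _ st)/(limg_dim_eq_ker ker_sub (esym dE)).
apply/eqP; rewrite eqn_leq (limg_dim_le ker_sub) andbT; apply: limg_dim_le.
move=> Lam LU /(restrict_eq0 _ st') L0.
by apply/(restrict_eq0 _ st)/(H _ LU).
Qed.

(** The image on the right lies in the one on the left, so equal dimensions mean that every
    functional prolongs. *)
Lemma dim_restrict_plusE s t B : (s <= t)%N ->
  \dim (restrict F n s t @: perp t B) =
    \dim (restrict F n s t.+1 @: perp t.+1 (plus_set B)) <->
  (forall Lam, Lam \in perp t B ->
     exists2 Lam', Lam' \in perp t.+1 (plus_set B) &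
       forall p, (msize p <= s.+1)%N -> mev Lam' p = mev Lam p).
Proof.
move=> st; have st1 := leqW st.
have plus_sub : (restrict F n s t.+1 @: perp t.+1 (plus_set B) <=
    restrict F n s t @: perp t B)%VS.
  apply/subvP => _ /memv_imgP[Lam /perp_plus_restrict LB ->].
  have -> : restrict F n s t.+1 Lam =
      restrict F n s t (restrict F n t t.+1 Lam).
    apply/(eq_restrict _ _ st1 st) => p sp; rewrite mev_restrict //.
    exact: leq_trans sp _.
  exact: memv_img.
split=> [dE Lam LB|H].
  have /eqP imgE : (restrict F n s t.+1 @: perp t.+1 (plus_set B) ==
      restrict F n s t @: perp t B)%VS by rewrite eqEdim plus_sub dE /=.
  have : restrict F n s t Lam \in (restrict F n s t @: perp t B)%VS.
    exact: memv_img.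
  rewrite -imgE => /memv_imgP[Lam' L'B /esym/(eq_restrict _ _ st1 st) L'E].
  by exists Lam'.
congr (\dim _); apply/eqP; rewrite eqEsubv plus_sub andbT.
apply/subvP => _ /memv_imgP[Lam /H[Lam' L'B L'E] ->].
by have /(eq_restrict _ _ st1 st) <- := L'E; apply: memv_img.
Qed.

End DualFunctionals.

(** * Positive semidefinite moment matrices *)

Section PsdKernel.
Context (R : realType) (n : nat) (ell : {scalar {mpoly R[n]}}) (k : nat).
Context (psd_ell : psd (hankel_mx ell k)).
Implicit Types (p u : {mpoly R[n]}).

Lemma psd_sqr u : (msize u <= k.+1)%N -> 0 <= ell (u * u).
Proof.
move=> su; have [_ /(_ (\col_j u@_(mindex_val j)))] := psd_ell.
rewrite -mulmxA mxE; congr (0 <= _); rewrite [in RHS](coef_sumE su).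
rewrite mulr_suml linear_sum; apply: eq_bigr => i _.
by rewrite hankel_mulE // -scalerAl linearZ /= !mxE -coef_sumE.
Qed.

(* Positivity of [ell ((p + c x^a)^2)] for all [c] makes the cross term vanish. *)
Lemma isker_psd p : (msize p <= k.+1)%N -> ell (p * p) = 0 -> isker ell k p.
Proof.
move=> sp pp; split=> // a ak.
set x := ell _; pose y := ell ('X_[a] * 'X_[a]).
have sX : (msize ('X_[a] : {mpoly R[n]}) <= k.+1)%N by rewrite msizeX.
have y0 : 0 <= y by apply: psd_sqr.
have H c : 0 <= c * (2 * x) + c ^+ 2 * y.
  have -> : c * (2 * x) + c ^+ 2 * y =
      ell ((c *: 'X_[a] + p) * (c *: 'X_[a] + p)).
    have -> : (c *: 'X_[a] + p) * (c *: 'X_[a] + p) =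
      (c * 2) *: ('X_[a] * p) + (c ^+ 2) *: ('X_[a] * 'X_[a]) + p * p.
      by rewrite -!mul_mpolyC mpolyCM; ring.
    by rewrite !linearD !linearZ /= pp addr0 -/x -/y mulrA.
  by apply: psd_sqr; apply: (lin_closed_msize R n k.+1).2.
(* The minimizer [-x / y] fails for [y = 0]; with [y + 1] the value is still a negative multiple of
   [x ^+ 2]. *)
have := H (- x / (y + 1)).
have y1 : 0 < y + 1 by apply: ltr_wpDl.
have -> : - x / (y + 1) * (2 * x) + (- x / (y + 1)) ^+ 2 * y =
    - (x ^+ 2 * ((y + 2) / (y + 1) ^+ 2)).
  by field; rewrite gt_eqF.
rewrite oppr_ge0 pmulr_lle0; last first.
  by apply: divr_gt0; [apply: ltr_wpDl | apply: exprn_gt0].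
by rewrite real_exprn_even_le0 ?num_real //= => /eqP.
Qed.

(** An element [p] of the smaller kernel has [ell (p * p) = 0], and [isker_psd] concludes. *)
Lemma isker_psd_widen s p : (s <= k)%N -> isker ell s p -> isker ell k p.
Proof.
move=> sk pk; have [sp _] := pk; apply: isker_psd; last exact: iskerM pk sp.
exact: leq_trans sp _.
Qed.

End PsdKernel.

(** * Flatness and prolongation *)

Section Corollary.
Context (R : realType) (n m : nat) (h : 'I_m -> {mpoly R[n]}).
Implicit Types (p q g : {mpoly R[n]}) (a : 'X_{1..n}).

Section Perps.
Context (t : nat) (L : dualle R n t).

Lemma ker_momentE s p : ker_moment s L p <-> isker (mev L) s p.
Proof. by rewrite iskerP. Qed.

Lemma msize_Hset p : Hset h t p -> (msize p <= t.+1)%N.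
Proof.
move=> [a [j [aj ->]]]; apply: leq_trans (msizeXM_leq _ (leqSpred _)) _.
by rewrite ltnS.
Qed.

Lemma msize_Wset p : Wset L p -> (msize p <= t.+1)%N.
Proof.
move=> [a [g [at2 [sg _] ->]]]; apply: leq_trans (msizeXM_leq _ sg) _.
by lia.
Qed.

Lemma mem_perp_Gset (Lam : dualle R n t) :
  Lam \in perp t (Gset h L) <->
    (forall p, Hset h t p -> mev Lam p = 0) /\
    (forall a g, (mdeg a <= t./2)%N -> isker (mev L) t./2 g ->
       mev Lam ('X_[a] * g) = 0).
Proof.
rewrite mem_perp; split=> [LG|[LH LW] p sp].
  split=> [p Hp|a g at2 gk].
    by apply: LG; [apply: msize_Hset | left].
  have Wp : Wset L ('X_[a] * g) by exists a, g; split=> //; apply/ker_momentE.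
  by apply: LG; [apply: msize_Wset | right].
case; first exact: LH.
by move=> [a [g [at2 /ker_momentE gk ->]]]; apply: LW.
Qed.

Context (s : nat) (LK : Kpsd h L) (st : (s <= t./2)%N).
Context (hs : forall j, (mdegree (h j) <= s)%N).

Let st2 : (2 * s <= t)%N. Proof. by lia. Qed.

Lemma Kpsd_mem_perp : L \in perp t (Gset h L).
Proof.
have [/mem_perp LH _] := LK; apply/mem_perp_Gset; split.
  by move=> p Hp; apply: LH => //; apply: msize_Hset.
by move=> a g at2 [_ gk]; apply: gk.
Qed.

Lemma isker_widen q : isker (mev L) s q -> isker (mev L) t./2 q.
Proof. by apply: isker_psd_widen st; case: LK. Qed.

(** For [mdeg a <= s] the product [x^a h_j] has degree at most [2 * s <= t], so it is in
    [Hset h t]. *)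
Lemma isker_generator j : isker (mev L) s (h j).
Proof.
have hsz : (msize (h j) <= (mdegree (h j)).+1)%N by apply: leqSpred.
split=> [|a sa]; first by apply: leq_trans hsz _; rewrite ltnS.
have /mem_perp_Gset[LH _] := Kpsd_mem_perp.
apply: LH; exists a, j; split=> //; apply: leq_trans st2.
by rewrite mul2n -addnn leq_add.
Qed.

(** * From flatness to determination and prolongation *)

Section Flat.
Context (k : nat) (sE : s = k.+1).
Context (rho : {linear {mpoly R[n]} -> {mpoly R[n]}}).
Context (rho_size : forall p, (msize (rho p) <= k.+1)%N).
Context (rho_res :
  forall p, (msize p <= k.+2)%N -> isker (mev L) k.+1 (p - rho p)).
Context (rho_ker : forall p, isker (mev L) k.+1 p -> rho p = 0).

Let iskerXs (Lam : dualle R n t) a q : Lam \in perp t (Gset h L) ->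
  (mdeg a <= t./2)%N -> isker (mev L) k.+1 q -> mev Lam ('X_[a] * q) = 0.
Proof.
move=> /mem_perp_Gset[_ LW] ad qk; apply: LW => //.
by apply: isker_widen; rewrite sE.
Qed.

(** In degree [2 * s] the reduction only uses multipliers of degree at most [s <= t./2], whose
    products with kernel elements lie in [Wset L]. *)
Lemma flat_determined (Lam : dualle R n t) : Lam \in perp t (Gset h L) ->
    (forall p, (msize p <= s.-1.+1)%N -> mev Lam p = 0) ->
  forall p, (msize p <= (2 * s).+1)%N -> mev Lam p = 0.
Proof.
move=> LG L0 p sp; have [b sb Pb] := flat_reduction rho_size rho_res sp.
have := Pb _ (lin_closed_ker (mev Lam)).
rewrite linearB /= (L0 b) ?subr0 ?sE //; apply=> a q ad.
by apply: iskerXs LG _; lia.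
Qed.

Lemma flat_prolongation (Lam : dualle R n t) : Lam \in perp t (Gset h L) ->
  exists2 Lam' : dualle R n t.+1,
    Lam' \in perp t.+1 (plus_set (Gset h L)) &
    forall p, (msize p <= (2 * s).+1)%N -> mev Lam' p = mev Lam p.
Proof.
move=> LG.
have [|phi [phi_size phiXU phi_rho]] :=
  @flat_extension _ _ _ _ _ rho_size rho_res rho_ker t.+1; first by lia.
have phiX a e q : (msize q <= e.+1)%N -> (mdeg a + e <= t.+1)%N ->
    phi q = 0 -> phi ('X_[a] * q) = 0.
  move=> sq ae phiq; move: {2}(mdeg a) (erefl (mdeg a)) => d ad.
  elim: d => [|d IHd] in a ad ae *.
    by move/eqP: ad; rewrite mdeg_eq0 => /eqP ->; rewrite mpolyX0 mul1r.
  have [|b [i aE]] := @mnm_splitU n a; first by rewrite ad.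
  rewrite {}aE mdegD mdeg1 in ad ae *; rewrite mpolyXD -mulrA phiXU.
    by rewrite IHd ?mulr0 ?linear0 //; lia.
  by apply: leq_trans (msizeXM_leq b sq) _; lia.
have phi_ker q : isker (mev L) k.+1 q -> phi q = 0.
  by move=> qk; rewrite phi_rho ?rho_ker //; case: qk.
(* The reduction [b] of [g] has degree at most [k] and [L] vanishes on its multiples by [x^a],
   [mdeg a <= k]; so [b] is in the kernel by [flat_isker], and [phi] kills both [b] and [g - b]. *)
have phi_N g : isker (mev L) t./2 g -> phi g = 0.
  move=> [sg gk]; have [b sb Pb] := flat_reduction rho_size rho_res sg.
  have bk : isker (mev L) k.+1 b.
    apply: flat_isker rho_size rho_res _ _ _; first exact: leqW.
    move=> a ak.
    have := Pb (fun u => mev L ('X_[a] * u) = 0).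
    rewrite mulrBr linearB /= gk; last by lia.
    rewrite sub0r => H; apply/eqP; rewrite -oppr_eq0; apply/eqP; apply: H.
      split=> [|c u v Hu Hv]; first by rewrite mulr0 linear0.
      by rewrite mulrDr -scalerAr linearP /= Hu Hv mulr0 addr0.
    move=> b' q b'd qk; rewrite mulrA -mpolyXD.
    by apply: iskerXs Kpsd_mem_perp _ qk; rewrite mdegD; lia.
  have := Pb _ (lin_closed_ker phi).
  rewrite linearB /= (phi_ker b) // subr0; apply => a q ad qk.
  have [sq _] := qk; apply: phiX sq _ (phi_ker _ qk); lia.
(* The prolongation is [Lam] composed with the normal form. *)
pose f p := mev Lam (phi p).
have f_lin : scalar f by move=> c p q; rewrite /f !linearP.
pose fL : {scalar {mpoly R[n]}} :=
  HB.pack f (GRing.isLinear.Build _ _ _ _ f f_lin).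
have [Lam' L'E] := scalar_dualle t.+1 fL; exists Lam'.
  have phiG p : Gset h L p -> phi p = 0.
    case=> [[a [j [aj ->]]]|[a [g [at2 /ker_momentE gk ->]]]].
      apply: phiX (leqSpred _) (leqW aj) _.
      by apply: phi_ker; rewrite -sE; apply: isker_generator.
    have [sg _] := gk; apply: phiX sg _ (phi_N _ gk); lia.
  have sG p : Gset h L p -> (msize p <= t.+1)%N.
    by case; [apply: msize_Hset | apply: msize_Wset].
  apply/mem_perp => p sp Gp; rewrite L'E //= /f.
  case: Gp => [Gp|[i [q Gq ->]]]; first by rewrite phiG // linear0.
  by rewrite phiXU ?sG // phiG // mulr0 !linear0.
move=> p sp; rewrite L'E /= /f; last first.
  by apply: leq_trans sp _; rewrite ltnS; lia.
(* Both sides are compared through the reduction [b] of [p]: [phi p = rho b], [Lam p = Lam b], and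
   [b - rho b] is in the kernel. *)
have [b sb Pb] := flat_reduction rho_size rho_res sp.
have /eqP : mev Lam (p - b) = 0.
  by apply: Pb (lin_closed_ker _) _ => a q ad; apply: iskerXs LG _; lia.
rewrite linearB subr_eq0 => /eqP ->.
have /eqP : phi (p - b) = 0.
  apply: Pb (lin_closed_ker phi) _ => a q ad qk.
  have [sq _] := qk; apply: phiX sq _ (phi_ker _ qk); lia.
rewrite linearB subr_eq0 => /eqP ->.
rewrite phi_rho; last exact: leqW.
apply/eqP; rewrite eq_sym -subr_eq0 -linearB; apply/eqP.
have := iskerXs (a := 0%MM) LG _ (rho_res (leqW sb)).
by rewrite mpolyX0 mul1r; apply; rewrite mdeg0; lia.
Qed.

End Flat.

(** * From determination and prolongation back to flatness *)

Section Stable.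
Context (k : nat) (sE : s = k.+1).
Let G := perp t (Gset h L).
Let Gplus := perp t.+1 (plus_set (Gset h L)).
Context (det : forall Lam, Lam \in G ->
  (forall p, (msize p <= s.-1.+1)%N -> mev Lam p = 0) ->
  forall p, (msize p <= (2 * s).+1)%N -> mev Lam p = 0).
Context (prolong : forall Lam, Lam \in G ->
  exists2 Lam', Lam' \in Gplus &
    forall p, (msize p <= (2 * s).+1)%N -> mev Lam' p = mev Lam p).

(** One variable at a time: prolong [Lam], then shift the prolongation by [x_i] to land in [G]
    again. The bounds on [a] and [q] keep all degrees within [2 * s]. *)
Lemma perp_stable a q :
    (forall Lam, Lam \in G -> mev Lam q = 0) ->
    (msize q <= s.+1)%N -> (mdeg a <= s)%N ->
  forall Lam, Lam \in G -> mev Lam ('X_[a] * q) = 0.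
Proof.
move=> Gq sq; move: {2}(mdeg a) (erefl (mdeg a)) => d ad.
elim: d => [|d IHd] in a ad *.
  by move/eqP: ad; rewrite mdeg_eq0 => /eqP ->; rewrite mpolyX0 mul1r.
have [|b [i aE]] := @mnm_splitU n a; first by rewrite ad.
rewrite {}aE mdegD mdeg1 in ad * => bs Lam LG.
have sbq := msizeXM_leq b sq.
have [Lam' L'G L'E] := prolong LG.
have [Lam2 L2G L2E] := perp_plus_shift i L'G.
rewrite mpolyXD -mulrA -L'E.
  rewrite -L2E; first by apply: IHd => //; lia.
  by apply: leq_trans sbq _; lia.
by apply: leq_trans (msizeXUM_leq i sbq) _; lia.
Qed.

Lemma stable_flat :
  \rank (hankel_mx (mev L) k.+1) = \rank (hankel_mx (mev L) k).
Proof.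
apply: flat_mxrank => a ak.
pose e i : {scalar dualle R n t} :=
  @mev_at R n t ('X_[@mindex_val n k i] : {mpoly R[n]}).
pose f : {scalar dualle R n t} := @mev_at R n t ('X_[a] : {mpoly R[n]}).
(* By [det], an element of [G] vanishing on the monomials of degree at most [k] vanishes at [x^a];
   so on [G] the evaluation at [x^a] is a combination of theirs, with coefficients those of [p]. *)
have [Lam LG Lk|c cE] := @dual_span _ _ G _ e f.
  apply: (det LG); last by rewrite msizeX; lia.
  rewrite sE => p sp.
  apply: (lin_closed_mpoly (lin_closed_ker (mev Lam)) _ sp).
  by move=> b /mindex_valK[i <-]; apply: (Lk i).
pose p : {mpoly R[n]} := \sum_i c i *: 'X_[@mindex_val n k i].
have sp : (msize p <= k.+1)%N.
  apply: (lin_closed_sum (P := fun q => (msize q <= k.+1)%N)).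
    exact: lin_closed_msize.
  by move=> i; rewrite msizeX ltnS mdeg_mindex_val.
exists p => //; have sq : (msize ('X_[a] - p) <= k.+2)%N.
  by apply: msizeB_leq; [rewrite msizeX | apply: leqW].
split=> // b bk; apply: perp_stable; rewrite ?sE ?Kpsd_mem_perp //.
move=> Lam /cE; rewrite linearB linear_sum => fE.
apply/eqP; rewrite subr_eq0; apply/eqP; rewrite [LHS]fE.
by apply: eq_bigr => i _; rewrite linearZ.
Qed.

End Stable.

End Perps.

End Corollary.

Theorem corollary13 (R : realType) (n m : nat) (h : 'I_m -> {mpoly R[n]})
    (s t : nat) (L : dualle R n t) :
  (1 <= s)%N ->
  (\max_(j < m) mdegree (h j) <= s)%N ->
  (s <= t./2)%N ->
  generic h L ->
  let G := perp t (Gset h L) in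
  let Gplus := perp t.+1 (plus_set (Gset h L)) in
  let rank_cond := \rank (moment_mx s L) = \rank (moment_mx s.-1 L) in
  let P2 :=
    \dim (restrict R n (2 * s) t @: G) = \dim (restrict R n s.-1 t @: G) /\
    \dim (restrict R n (2 * s) t @: G)
      = \dim (restrict R n (2 * s) t.+1 @: Gplus) in
  let P1 :=
    \dim (restrict R n s t @: G) = \dim (restrict R n s.-1 t @: G) /\
    \dim (restrict R n s t @: G) = \dim (restrict R n s t.+1 @: Gplus) in
  (rank_cond <-> P2) /\ (P2 -> P1).
Proof.
move=> s0 /bigmax_leqP hs st [LK _] G Gplus.
case: s s0 hs st => // k _ hs st rank_cond P2 P1.
have hs' j : (mdegree (h j) <= k.+1)%N by apply: hs.
have s2t : (2 * k.+1 <= t)%N by lia.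
have s1t : (k.+1 <= t)%N by lia.
have k2s : (k.+1.-1 <= 2 * k.+1)%N by lia.
split; first split=> [rkE|[/dim_restrictE det /dim_restrict_plusE prolong]].
- have [rho [rho_size rho_res rho_ker]] := flat_projection (ell := mev L) rkE.
  split; [apply/dim_restrictE|apply/dim_restrict_plusE] => // Lam LG.
    exact: flat_determined LG.
  exact: flat_prolongation LG.
- exact: stable_flat (det k2s s2t) (prolong s2t).
(* (P1) asks for the same determination and prolongation up to degree [s] only. *)
move=> [/dim_restrictE det /dim_restrict_plusE prolong].
have sp2 (p : {mpoly R[n]}) :
    (msize p <= k.+2)%N -> (msize p <= (2 * k.+1).+1)%N.
  by move=> sp; apply: leq_trans sp _; lia.
split; [apply/dim_restrictE|apply/dim_restrict_plusE] => //.
  by move=> Lam LG L0 p /sp2; apply: det k2s s2t _ LG L0 p.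
move=> Lam /(prolong s2t)[Lam' L'G L'E].
by exists Lam' => // p /sp2/L'E.
Qed.
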